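(* Let $a>0$, $\lambda\in\mathbb{R}$, let $(\gamma_n)_{n\ge0}$ be i.i.d. with law $GIG(\lambda,a,a)$, and for $n\ge1$ let $$X_n=\prod_{i=0}^{n-1}\gamma_i,\qquad Z_n=\sum_{k=0}^{n-1}\Big(\prod_{i=0}^{k-1}\gamma_i^{-1}\Big)\Big(\prod_{j=k+1}^{n-1}\gamma_j\Big),\qquad N_n^{(\lambda)}=X_n^{-1}Z_n .$$ When $\lambda>0$, with $N_\infty^{(\lambda)}=\lim_{n\to+\infty}N_n^{(\lambda)}$ (almost sure limit), almost surely for all $n\ge1$, $$\log(X_n)=\log\left(\frac{Z_n}{N_\infty^{(\lambda)}}\right)+\log\left(1+N_\infty^{(\lambda)}\sum_{k=1}^{+\infty}\frac{1}{Z_{n+k-1}Z_{n+k}}\right).$$ When $\lambda\le0$, almost surely for all $n\ge1$, $$\log(X_n)=\log(Z_n)+\log\left(\sum_{k=1}^{+\infty}\frac{1}{Z_{n+k-1}Z_{n+k}}\right).$$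
   Context: Empty products equal $1$. For $a>0$ and $\lambda\in\mathbb{R}$, $GIG(\lambda,a,a)$ (Generalized Inverse Gaussian) is the probability law on $(0,+\infty)$ with density $x\mapsto \frac{1}{2K_\lambda(a^2)}x^{\lambda-1}e^{-\frac{a^2}{2}(x+\frac1x)}$, where $K_\lambda(z)=\frac12\int_0^{+\infty}x^{\lambda-1}e^{-\frac z2(x+\frac1x)}dx$ for $z>0$ is the Macdonald function. Explicitly, $N_n^{(\lambda)}=\sum_{k=0}^{n-1}\gamma_k^{-1}\big(\prod_{i=0}^{k-1}\gamma_i^{-1}\big)^2$; for $\lambda>0$ it converges almost surely to a finite limit. *)

(* Defs.v *)
From HB Require Import structures.
From mathcomp Require Import all_boot all_order all_algebra.
From mathcomp Require Import all_classical all_reals all_analysis.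
Import Order.TTheory GRing.Theory Num.Theory.
Import numFieldNormedType.Exports.

Set Implicit Arguments.
Unset Strict Implicit.
Unset Printing Implicit Defensive.

Local Open Scope classical_set_scope.
Local Open Scope ring_scope.

Definition macdonald (R : realType) (lambda z : R) : R :=
  2^-1 * \int[lebesgue_measure]_(x in `]0, +oo[)
    (x `^ (lambda - 1) * expR (- (z / 2) * (x + x^-1))).

(* density of GIG(lambda, a, a) with respect to Lebesgue measure, extended by 0
   outside of ]0, +oo[ *)
Definition gig_pdf (R : realType) (lambda a x : R) : R :=
  if 0 < x then
    (2 * macdonald lambda (a ^+ 2))^-1 * x `^ (lambda - 1) *
      expR (- (a ^+ 2 / 2) * (x + x^-1))
  else 0.

Definition gig_law (R : realType) (lambda a : R) (d : measure_display)
    (T : measurableType d) (P : probability T R) (X : {RV P >-> R}) : Prop :=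
  forall A : set R, measurable A ->
    distribution P X A =
    (\int[lebesgue_measure]_(x in A) (gig_pdf lambda a x)%:E)%E.

(* mutual independence of the whole sequence: product rule over every finite set
   of indices, listed without repetition by s *)
Definition independent_seq (R : realType) (d : measure_display)
    (T : measurableType d) (P : probability T R)
    (X : nat -> {RV P >-> R}) : Prop :=
  forall (s : seq nat) (A : nat -> set R), uniq s ->
    (forall i, measurable (A i)) ->
    P (\bigcap_(i in [set` s]) (X i @^-1` A i)) =
    (\prod_(i <- s) P (X i @^-1` A i))%E.

(* pathwise definitions: g is one trajectory of the random sequence *)
Definition Xseq (R : realType) (g : nat -> R) (n : nat) : R :=
  \prod_(0 <= i < n) g i.

Definition Zseq (R : realType) (g : nat -> R) (n : nat) : R :=
  \sum_(0 <= k < n)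
    (\prod_(0 <= i < k) (g i)^-1) * (\prod_(k.+1 <= j < n) g j).

Definition Nseq (R : realType) (g : nat -> R) (n : nat) : R :=
  (Xseq g n)^-1 * Zseq g n.

(* 1 / (Z_(n+k-1) Z_(n+k)), used for k >= 1 *)
Definition Zterm (R : realType) (g : nat -> R) (n k : nat) : R :=
  (Zseq g (n + k - 1) * Zseq g (n + k))^-1.

(* k ranges over 1, ..., m - 1 *)
Definition Zpartial (R : realType) (g : nat -> R) (n m : nat) : R :=
  \sum_(1 <= k < m) Zterm g n k.

(* Main.v *)
(* Write N_n for N_n^(lambda). Along a positive path N_(n+1) - N_n = 1 / (X_n X_(n+1))
   and Z_n = X_n N_n, hence 1 / (Z_n Z_(n+1)) = 1 / N_n - 1 / N_(n+1): the series
   telescopes to 1 / N_n - 1 / lim N, and both identities are deterministic once it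
   is known that N is bounded (lambda > 0) or unbounded (lambda <= 0).

   The substitution x -> 1/x shows that 1 / gamma has density x^(-2 lambda) times the
   density of gamma. Hence E gamma^(-2 lambda) = 1 and, since gamma^(-lambda) is not
   almost surely 1, E (1 - gamma^(-lambda))^2 > 0 gives E gamma^(-lambda) < 1 for
   lambda <> 0. By independence E X_n^(-lambda) decays geometrically, and by
   Borel-Cantelli so does X_n^(-lambda): the increments of N are then geometrically
   small if lambda > 0, and eventually at least 1 if lambda < 0.

   For lambda = 0 the law of gamma is invariant under inversion. Boundedness of N does
   not depend on finitely many factors, so it is independent of every event N_n <= M,
   hence of itself, and its probability p satisfies p = p^2. Since a + 1/a >= 1, the
   sequences N built from gamma and from 1 / gamma cannot both be bounded, so
   p <= 1 - p and p = 0. *)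

Require Import Defs.
From HB Require Import structures.
From mathcomp Require Import all_boot all_order all_algebra.
From mathcomp Require Import all_classical all_reals all_analysis.
From mathcomp Require Import measurable_realfun ring lra.
Import Order.TTheory GRing.Theory Num.Theory.
Import numFieldNormedType.Exports.

Set Implicit Arguments.
Unset Strict Implicit.
Unset Printing Implicit Defensive.

Local Open Scope classical_set_scope.
Local Open Scope ring_scope.

(** * Deterministic identities for $X_n$, $Z_n$ and $N_n$ along one path *)

Section pathwise.
Context (R : realType).
Implicit Types (g : nat -> R) (n m k : nat).

Lemma Xseq0 g : Xseq g 0 = 1.
Proof. by rewrite /Xseq big_geq. Qed.

Lemma XseqS g n : Xseq g n.+1 = Xseq g n * g n.
Proof. by rewrite /Xseq big_nat_recr. Qed.

Lemma Xseq_gt0 g n : (forall i, 0 < g i) -> 0 < Xseq g n.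
Proof. by move=> g0; rewrite /Xseq; apply: prodr_gt0. Qed.

Lemma XseqD g n m : Xseq g (n + m) = Xseq g n * Xseq (fun i => g (n + i)%N) m.
Proof.
elim: m => [|m IH]; first by rewrite addn0 Xseq0 mulr1.
by rewrite addnS !XseqS IH mulrA.
Qed.

Lemma XseqV g n : Xseq (fun i => (g i)^-1) n = (Xseq g n)^-1.
Proof. by rewrite /Xseq prodfV. Qed.

Lemma Nseq0 g : Nseq g 0 = 0.
Proof. by rewrite /Nseq /Zseq big_geq // mulr0. Qed.

(** A new factor turns $Z_n$ into $Z_n g_n + X_n^{-1}$, the last term being the summand $k = n$;
    division by $X_{n+1} = X_n g_n$ gives the increment. *)
Lemma NseqS g n : (forall i, 0 < g i) ->
  Nseq g n.+1 = Nseq g n + (Xseq g n * Xseq g n.+1)^-1.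
Proof.
move=> g0; have gn0 := lt0r_neq0 (g0 n); have X0 := lt0r_neq0 (Xseq_gt0 n g0).
have -> : Nseq g n.+1 = (Xseq g n * g n)^-1 * (Zseq g n * g n + (Xseq g n)^-1).
  rewrite /Nseq XseqS /Zseq big_nat_recr //= [X in _ + _ * X]big_geq // mulr1.
  rewrite -/(Xseq (fun i => (g i)^-1) n) XseqV.
  congr (_ * (_ + _)); rewrite mulr_suml; apply: eq_big_nat => k /andP[_ kn].
  by rewrite big_nat_recr //= mulrA.
by rewrite /Nseq XseqS; field; rewrite gn0 X0.
Qed.

Lemma eq_Xseq g g' n : (forall i, (i < n)%N -> g i = g' i) -> Xseq g n = Xseq g' n.
Proof. by move=> gg'; apply: eq_big_nat => i /andP[_ /gg']. Qed.

Lemma eq_Nseq g g' n : (forall i, (i < n)%N -> g i = g' i) -> Nseq g n = Nseq g' n.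
Proof.
move=> gg'; rewrite /Nseq (eq_Xseq gg'); congr (_ * _).
apply: eq_big_nat => k /andP[_ kn]; congr (_ * _).
- by apply: eq_big_nat => i /andP[_ ik]; rewrite gg' // (ltn_trans ik).
- by apply: eq_big_nat => i /andP[_ ik]; rewrite gg'.
Qed.

Section positive.
Variables (g : nat -> R) (g0 : forall i, 0 < g i).

Lemma Nseq_nd : nondecreasing_seq (Nseq g).
Proof.
apply/nondecreasing_seqP => n.
by rewrite NseqS // lerDl invr_ge0 mulr_ge0 // ltW // Xseq_gt0.
Qed.

Lemma Nseq_ge0 n : 0 <= Nseq g n.
Proof. by rewrite -(Nseq0 g); exact: Nseq_nd. Qed.

Lemma Nseq_gt0 n : (0 < n)%N -> 0 < Nseq g n.
Proof.
case: n => // n _; rewrite NseqS // ltr_wpDl ?Nseq_ge0 //.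
by rewrite invr_gt0 mulr_gt0 // Xseq_gt0.
Qed.

Lemma ZseqE n : Zseq g n = Xseq g n * Nseq g n.
Proof. by rewrite /Nseq mulrA divff ?mul1r // lt0r_neq0 // Xseq_gt0. Qed.

(** $X_{n+m}$ is $X_n$ times a product of the shifted path, so every increment of the shifted
    sequence picks up the factor $X_n^{-2}$. This makes boundedness of [Nseq] a tail property
    ([bounded_shift]). *)
Lemma NseqD n m :
  Nseq g (n + m) =
  Nseq g n + (Xseq g n)^-2 * Nseq (fun i => g (n + i)%N) m.
Proof.
elim: m => [|m IH]; first by rewrite addn0 Nseq0 mulr0 addr0.
rewrite addnS NseqS // IH [in RHS]NseqS // mulrDr addrA; congr (_ + _).
by rewrite -addnS !XseqD expr2 !invfM; ring.
Qed.

(** Since $Z_k = X_k N_k$, the terms are $(N_{k+1} - N_k) / (N_k N_{k+1})$. The $m - 1$ summands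
    lead from index $n$ to index $n + m - 1$. *)
Lemma Zpartial_telescope n m : (0 < n)%N -> (0 < m)%N ->
  Zpartial g n m = (Nseq g n)^-1 - (Nseq g (n + m - 1))^-1.
Proof.
move=> n0; case: m => // m _; elim: m => [|m IH].
  by rewrite /Zpartial big_geq // addnK subrr.
rewrite /Zpartial big_nat_recr //= -/(Zpartial g n m.+1) IH /Zterm.
rewrite !addnS !subSS !subn0 !ZseqE.
have N0 := lt0r_neq0 (Nseq_gt0 (ltn_addr m n0)).
have N1 := lt0r_neq0 (Nseq_gt0 (ltn0Sn (n + m)%N)).
rewrite -addrA; congr (_ + _).
have X0 := lt0r_neq0 (Xseq_gt0 (n + m) g0).
have X1 := lt0r_neq0 (Xseq_gt0 (n + m).+1 g0).
move: N1; rewrite NseqS // => N1.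
field.
rewrite X1 X0 N0 andbT /= gt_eqF // ltr_wpDl // mulr_ge0 ?Nseq_ge0 //.
by rewrite mulr_ge0 // ltW // Xseq_gt0.
Qed.

(** The parameter [L] covers both regimes: the inverse of the limit of [Nseq] in the bounded case,
    $0$ in the unbounded one. *)
Lemma Zpartial_cvg n L : (0 < n)%N -> (Nseq g k)^-1 @[k --> \oo] --> L ->
  Zpartial g n @ \oo --> (Nseq g n)^-1 - L.
Proof.
(* Telescoping requires $m \ge 1$, whence the shift by one. *)
move=> n0 cL; rewrite -(cvg_shiftn 1) /=.
rewrite (_ : (fun m => _) = fun m => (Nseq g n)^-1 - (Nseq g (m + n))^-1).
  by apply: cvgB; [exact: cvg_cst|rewrite (cvg_shiftn n (fun k => (Nseq g k)^-1))].
by apply/funext => m; rewrite addn1 Zpartial_telescope // addnS subn1 addnC.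
Qed.

Lemma ln_Xseq_bounded : has_ubound (range (Nseq g)) ->
  cvgn (Nseq g) /\
  forall n : nat, (1 <= n)%N ->
    cvgn (Zpartial g n) /\
    ln (Xseq g n) = ln (Zseq g n / limn (Nseq g)) +
                    ln (1 + limn (Nseq g) * limn (Zpartial g n)).
Proof.
move=> ub; have cN := nondecreasing_is_cvgn Nseq_nd ub.
split => // n n0; set N := limn (Nseq g).
have N_gt n' : Nseq g n' <= N by exact: (nondecreasing_cvgn_le Nseq_nd cN).
have N0 : 0 < N by exact: lt_le_trans (Nseq_gt0 n0) (N_gt n).
have Nn0 := Nseq_gt0 n0; have Xn0 := Xseq_gt0 n g0.
have cZ : Zpartial g n @ \oo --> (Nseq g n)^-1 - N^-1.
  apply: Zpartial_cvg => //; apply: (cvgV _ cN).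
  by rewrite lt0r_neq0.
split; first by apply/cvg_ex; exists ((Nseq g n)^-1 - N^-1).
(* Here $1 + N (1/N_n - 1/N) = N/N_n$, whose product with $Z_n/N = X_n N_n/N$ is $X_n$. *)
rewrite (cvg_lim _ cZ) // ZseqE // mulrBr divff ?lt0r_neq0 // subrKC.
have A0 : 0 < Xseq g n * Nseq g n / N by rewrite divr_gt0 // mulr_gt0.
have B0 : 0 < N / Nseq g n by rewrite divr_gt0.
rewrite -lnM ?posrE //; congr ln.
by field; rewrite !lt0r_neq0.
Qed.

Lemma ln_Xseq_unbounded : ~ has_ubound (range (Nseq g)) ->
  forall n : nat, (1 <= n)%N ->
    cvgn (Zpartial g n) /\
    ln (Xseq g n) = ln (Zseq g n) + ln (limn (Zpartial g n)).
Proof.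
move=> nub n n0.
(* A nondecreasing sequence without finite limit tends to $+\infty$, so the series sums to $1/N_n$,
   and $Z_n/N_n = X_n$. *)
have Ny : Nseq g @ \oo --> +oo.
  apply: (nondecreasing_dvgn_lt Nseq_nd) => cN; apply: nub.
  by exists (limn (Nseq g)) => _ [k _ <-]; exact: (nondecreasing_cvgn_le Nseq_nd cN).
have cZ : Zpartial g n @ \oo --> (Nseq g n)^-1.
  rewrite -[X in _ --> X]subr0; apply: Zpartial_cvg => //.
  have Npos : \forall k \near \oo, 0 < Nseq g k.
    by exists 1%N => // k /= k1; exact: Nseq_gt0.
  exact: (gtr0_cvgV0 Npos).2.
split; first by apply/cvg_ex; exists (Nseq g n)^-1.
rewrite (cvg_lim _ cZ) // ZseqE //.
have Nn0 := Nseq_gt0 n0; have Xn0 := Xseq_gt0 n g0.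
have A0 : 0 < Xseq g n * Nseq g n by rewrite mulr_gt0.
rewrite -lnM ?posrE ?invr_gt0 //; congr ln.
by field; rewrite lt0r_neq0.
Qed.

End positive.
End pathwise.

(** * Integration against a measure given by a density *)

Section density.
Context d (T : measurableType d) (R : realType).
Variables (mu nu : {measure set T -> \bar R}) (h : T -> R).
Hypotheses (mh : measurable_fun setT h) (h0 : forall x, 0 <= h x).
Hypothesis nuE : forall A, measurable A -> nu A = (\int[mu]_(x in A) (h x)%:E)%E.
Local Open Scope ereal_scope.
Import HBNNSimple.

(** For indicators this is [nuE]; linearity extends it to simple functions, and monotone convergence
    on both sides to all nonnegative measurable [f]. *)
Lemma ge0_integral_density (f : T -> \bar R) :
  measurable_fun setT f -> (forall x, 0 <= f x) ->
  \int[nu]_x f x = \int[mu]_x (f x * (h x)%:E).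
Proof.
move=> mf f0; pose s := nnsfun_approx measurableT mf.
have s_cvg x : EFin \o s^~ x @ \oo --> f x by exact: cvg_nnsfun_approx.
have s_nd x m n : (m <= n)%N -> (s m x <= s n x)%R.
  by move=> mn; exact/lefP/nd_nnsfun_approx.
transitivity (limn (fun n => \int[nu]_x (s n x)%:E)).
  rewrite -monotone_convergence //=.
  - by apply: eq_integral => x _; apply/esym/cvg_lim => //; exact: s_cvg.
  - by move=> n; exact/measurable_EFinP.
  - by move=> n x _; rewrite lee_fin.
  - by move=> x _ m n mn; rewrite lee_fin s_nd.
transitivity (limn (fun n => \int[mu]_x ((s n x)%:E * (h x)%:E))); last first.
  rewrite -monotone_convergence //=.
  - apply: eq_integral => x _; apply/cvg_lim => //.
    by apply: cvgeZr => //; exact: s_cvg.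
  - by move=> n; apply: emeasurable_funM => //; exact/measurable_EFinP.
  - by move=> n x _; rewrite mule_ge0 // lee_fin.
  - by move=> x _ m n mn; rewrite lee_wpmul2r ?lee_fin ?s_nd.
congr (limn _); apply/funext => n.
have ms y : measurable (s n @^-1` [set y]).
  by apply: measurable_funPTI; exact: measurable_set1.
transitivity (\sum_(y \in range (s n)) y%:E * nu (s n @^-1` [set y])).
  by rewrite integralT_nnsfun sintegralE.
rewrite (eq_integral (fun x => \sum_(y \in range (s n))
    ((y * \1_(s n @^-1` [set y]) x)%:E * (h x)%:E))); last first.
  move=> x _; rewrite [in LHS]fimfunE -fsumEFin // ge0_mule_fsuml // => y.
  exact: nnfun_muleindic_ge0.
rewrite ge0_integral_fsum //; last 2 first.
- by move=> z; apply: emeasurable_funM; apply/measurable_EFinP => //; exact: measurable_funM.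
- move=> z x _; apply: mule_ge0; last by rewrite lee_fin.
  by rewrite EFinM nnfun_muleindic_ge0.
apply: eq_fsbigr => y /[!inE] -[t _ <-].
under [RHS]eq_integral do rewrite EFinM -muleA.
rewrite ge0_integralZl_EFin //; last 2 first.
- by move=> x _; rewrite mule_ge0 // lee_fin.
- by apply: emeasurable_funM => //; apply/measurable_EFinP.
congr (_ * _); rewrite nuE // integral_mkcond.
by apply: eq_integral => x _; rewrite epatch_indic muleC.
Qed.

End density.

(** * Image of a density on the positive half-line under $x \mapsto 1/x$ *)

Section inversion.
Context (R : realType).
Local Notation mu := (@lebesgue_measure R).

Lemma measurable_fun_inv : measurable_fun [set: R] (@GRing.inv R).
Proof.
rewrite -(setvU [set 0]); apply/measurable_funU; [exact: measurableC| |split].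
- exact: measurable_set1.
- apply: open_continuous_measurable_fun; first by rewrite openC; exact: closed_eq.
  by move=> x /[!inE] /eqP x0; exact: inv_continuous.
- exact: measurable_fun_set1.
Qed.

Lemma derive1_inv (x : R) : x != 0 -> (@GRing.inv R)^`()%classic x = - x ^- 2.
Proof.
move=> x0; rewrite derive1E (@deriveV _ _ id) // derive_id.
exact: mulr1.
Qed.

Lemma continuous_derive1_inv (x : R) : 0 < x ->
  {for x, continuous (@GRing.inv R)^`()%classic}.
Proof.
move=> x0; have xn0 := lt0r_neq0 x0.
have : (fun y : R => - y ^- 2) y @[y --> x] --> - x ^- 2.
  apply: cvgN; apply: cvgV; first by rewrite expf_neq0.
  exact: exprn_continuous.
rewrite -(derive1_inv xn0); apply: cvg_trans; apply: near_eq_cvg.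
by near=> y; rewrite derive1_inv // gt_eqF //; near: y; exact: lt_nbhsr.
Unshelve. all: end_near. Qed.

(** Substitution along a decreasing map: the reversed orientation absorbs the sign of the derivative
    $-x^{-2}$. *)
Lemma integral_inv_itv (h : R -> R) (a b : R) : 0 < a -> a <= b ->
  {in `]0, +oo[, continuous h} ->
  (\int[mu]_(x in `[(b^-1)%R, (a^-1)%R]) (h x)%:E =
   \int[mu]_(x in `[a, b]) (h x^-1 * x ^- 2)%:E)%E.
Proof.
move=> a0 ab ch; have b0 : 0 < b by exact: lt_le_trans ab.
rewrite (@integration_by_substitution_decreasing _ (@GRing.inv R) h a b) //.
- apply: eq_integral => x /[!inE] /=; rewrite in_itv /= => /andP[ax _].
  congr EFin; rewrite -[LHS]/(h x^-1 * - ((@GRing.inv R)^`()%classic x)).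
  by rewrite derive1_inv ?opprK // gt_eqF // (lt_le_trans a0).
- move=> x y /[!in_itv] /= /andP[ax _] /andP[ay _] xy.
  by rewrite ltf_pV2 // posrE (lt_le_trans a0).
- move=> x /[!in_itv] /= /andP[ax _]; apply: continuous_derive1_inv.
  exact: lt_trans ax.
- apply/cvg_ex; exists ((@GRing.inv R)^`()%classic a).
  by apply: cvg_at_right_filter; exact: continuous_derive1_inv.
- apply/cvg_ex; exists ((@GRing.inv R)^`()%classic b).
  by apply: cvg_at_left_filter; exact: continuous_derive1_inv.
- split.
  + move=> x /[!in_itv] /= /andP[ax _].
    by apply: derivableV => //; rewrite gt_eqF // (lt_trans a0).
  + by apply: cvg_at_right_filter; apply: inv_continuous; rewrite gt_eqF.
  + by apply: cvg_at_left_filter; apply: inv_continuous; rewrite gt_eqF.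
- apply: continuous_subspace_itv => x /[!in_itv] /= /andP[bx _].
  by apply: ch; rewrite in_itv /= andbT (lt_le_trans _ bx) ?invr_gt0.
Qed.

End inversion.

Section density_measure.
Context d (T : measurableType d) (R : realType).
Variables (mu : {measure set T -> \bar R}) (h : T -> R).

(* [mh] and [h0] do not occur in the body: they let the instance below be inferred. *)
Definition density_measure (mh : measurable_fun setT h) (h0 : forall x, 0 <= h x)
  (A : set T) : \bar R := (\int[mu]_(x in A) (h x)%:E)%E.

Hypotheses (mh : measurable_fun setT h) (h0 : forall x, 0 <= h x).
Local Notation nu := (density_measure mh h0).

Let nu0 : nu set0 = 0%E.
Proof. exact: integral_set0. Qed.

Let nu_ge0 A : (0 <= nu A)%E.
Proof. by apply: integral_ge0 => x _; rewrite lee_fin. Qed.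

Let nu_sigma_additive : semi_sigma_additive nu.
Proof.
move=> /= F mF tF mUF; apply: cvg_toP.
  apply: ereal_nondecreasing_is_cvgn => m n mn.
  by apply: lee_sum_nneg_natr => // k _ _; exact: nu_ge0.
rewrite /density_measure ge0_integral_bigcup //=.
- by apply/measurable_EFinP; exact: measurable_funTS.
- by move=> x _; rewrite lee_fin.
Qed.

HB.instance Definition _ := isMeasure.Build _ _ _ nu nu0 nu_ge0 nu_sigma_additive.

End density_measure.

Section inversion_density.
Context (R : realType).
Local Notation mu := (@lebesgue_measure R).
Variables (h : R -> R).
Hypotheses (mh : measurable_fun setT h) (h0 : forall x, 0 <= h x).
Hypothesis hN : forall x : R, x <= 0 -> h x = 0.
Hypothesis ch : {in `]0, +oo[, continuous h}.

(** Density of the image under inversion of the measure with density [h]; $x^{-2}$ is the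
    Jacobian. *)
Let k x := h x^-1 * x ^- 2.

Let mk : measurable_fun setT k.
Proof.
apply: measurable_funM; first exact: measurableT_comp mh (@measurable_fun_inv R).
by apply: measurableT_comp (@measurable_fun_inv R) _; exact: measurable_funX.
Qed.

Let k0 x : 0 <= k x.
Proof. by rewrite mulr_ge0 // invr_ge0 sqr_ge0. Qed.

Let kN x : x <= 0 -> k x = 0.
Proof. by move=> x0; rewrite /k hN ?mul0r // invr_le0. Qed.

(** [integral_inv_itv] handles compact intervals; both integrals are monotone limits along an
    exhaustion of $]x, +\infty[$ by such intervals. *)
Let integral_inv_oy (x : R) : 0 <= x ->
  (\int[mu]_(y in [set y | 0 < y /\ x < y^-1]%R) (h y)%:E =
   \int[mu]_(y in `]x, +oo[) (k y)%:E)%E.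
Proof.
move=> x0.
(* The lower end is positive even for $x = 0$, so that the inverse image [F' n] is again a compact
   interval. *)
pose F n : set R := `[x + n.+1%:R^-1, x + n.+1%:R]%classic.
pose F' n : set R := [set y | 0 < y /\ F n y^-1].
have lo n : 0 < x + n.+1%:R^-1 by rewrite ltr_wpDl // invr_gt0.
have le_lo_hi n : x + n.+1%:R^-1 <= x + n.+1%:R.
  by rewrite lerD2l (@le_trans _ _ 1) ?invf_le1 // ler1n.
have hi n : 0 < x + n.+1%:R by exact: lt_le_trans (lo n) (le_lo_hi n).
have F'E n : F' n = `[(x + n.+1%:R)^-1, (x + n.+1%:R^-1)^-1]%classic.
  apply/seteqP; split => y; rewrite /F' /F /= !in_itv /=.
    move=> [y0 /andP[yl yh]]; apply/andP; split.
      by rewrite -[leRHS]invrK lef_pV2 ?posrE // invr_gt0.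
    by rewrite -[leLHS]invrK lef_pV2 ?posrE // invr_gt0.
  move=> /andP[yl yh]; have y0 : 0 < y by rewrite (lt_le_trans _ yl) // invr_gt0.
  split=> //; apply/andP; split.
    by rewrite -[leLHS]invrK lef_pV2 ?posrE // invr_gt0.
  by rewrite -[leRHS]invrK lef_pV2 ?posrE // invr_gt0.
have ndF : nondecreasing_seq F.
  move=> m n mn; apply/subsetPset => y; rewrite /F /= !in_itv /= => /andP[yl yh].
  apply/andP; split.
    by rewrite (le_trans _ yl) // lerD2l lef_pV2 ?posrE // ler_nat.
  by rewrite (le_trans yh) // lerD2l ler_nat.
have ndF' : nondecreasing_seq F'.
  move=> m n mn; apply/subsetPset => y [y0 Fy]; split=> //.
  by have /subsetPset := ndF _ _ mn; apply.
have UF : \bigcup_n F n = `]x, +oo[%classic.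
  apply/seteqP; split => y.
    move=> [n _]; rewrite /F /= !in_itv /= andbT => /andP[yl _].
    by rewrite (lt_le_trans _ yl) // ltrDl invr_gt0.
  rewrite /= in_itv /= andbT => /ltr_add_invr[i xiy].
  (* The index [i] brings the lower end below $y$, and [Num.truncn y] the upper end above it. *)
  exists (maxn i (Num.truncn y)) => //; rewrite /F /= in_itv /=; apply/andP; split.
    rewrite (le_trans _ (ltW xiy)) // lerD2l lef_pV2 ?posrE // ler_nat.
    by rewrite ltnS leq_maxl.
  rewrite (le_trans (ltW (truncnS_gt y))) // (@le_trans _ _ ((maxn i (Num.truncn y)).+1%:R)) //.
    by rewrite ler_nat ltnS leq_maxr.
  by rewrite lerDr.
have UF' : \bigcup_n F' n = [set y | 0 < y /\ x < y^-1].
  apply/seteqP; split => y.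
    move=> [n _ [y0 Fy]]; split=> //.
    have : (\bigcup_n F n) y^-1 by exists n.
    by rewrite UF /= in_itv /= andbT.
  move=> [y0 xy]; have : (\bigcup_n F n) y^-1 by rewrite UF /= in_itv /= andbT.
  by move=> [n _ Fn]; exists n.
have mF n : measurable (F n) by exact: measurable_itv.
have mF' n : measurable (F' n) by rewrite F'E; exact: measurable_itv.
have c1 : (\int[mu]_(y in F n) (k y)%:E @[n --> \oo] -->
           \int[mu]_(y in `]x, +oo[) (k y)%:E)%E.
  rewrite -UF; apply: ge0_nondecreasing_set_cvg_integral => //.
  - by move=> n; apply/measurable_EFinP; exact: measurable_funTS.
  - by move=> n y _; rewrite lee_fin.
have c2 : (\int[mu]_(y in F' n) (h y)%:E @[n --> \oo] -->
           \int[mu]_(y in [set y | 0 < y /\ x < y^-1]%R) (h y)%:E)%E.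
  rewrite -UF'; apply: ge0_nondecreasing_set_cvg_integral => //.
  - by move=> n; apply/measurable_EFinP; exact: measurable_funTS.
  - by move=> n y _; rewrite lee_fin.
suff c3 : (\int[mu]_(y in F' n) (h y)%:E @[n --> \oo] -->
           \int[mu]_(y in `]x, +oo[) (k y)%:E)%E by exact: (cvg_unique _ c2 c3).
apply: cvg_trans c1; apply: near_eq_cvg.
by apply: nearW => n; rewrite F'E integral_inv_itv.
Qed.

(** Both sides are measures in [A], the left one finite, so it suffices to compare them on the rays
    $]x, +\infty[$, a $\pi$-system generating the Borel sets. *)
Lemma density_inv (nu : {measure set R -> \bar R}) : (nu setT < +oo)%E ->
  (forall A, measurable A -> nu A = (\int[mu]_(x in A) (h x)%:E)%E) ->
  forall A, measurable A ->
  nu (@GRing.inv R @^-1` A) = (\int[mu]_(x in A) (h x^-1 * x ^- 2)%:E)%E.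
Proof.
move=> nuoo nuE A mA.
pose inv : {mfun R >-> R} := HB.pack (@GRing.inv R)
  (isMeasurableFun.Build _ _ _ _ _ (@measurable_fun_inv R)).
have m_inv B : measurable B -> measurable (@GRing.inv R @^-1` B).
  by move=> mB; exact: (measurable_funPTI inv).
(* [R] and [measurableTypeR R], the carrier of Lebesgue measure, have the same
   measurable sets but structures that unification does not identify. *)
pose m2 (B : set R) := density_measure mu mk k0 B.
have m2_sa : semi_sigma_additive m2.
  by move=> F mF tF mUF; exact: (@measure_semi_sigma_additive _ _ _ (density_measure mu mk k0)).
pose m2' : {measure set R -> \bar R} := HB.pack m2
  (isMeasure.Build _ R R m2 (measure0 (density_measure mu mk k0))
     (measure_ge0 (density_measure mu mk k0)) m2_sa).
have := @measure_unique _ R R (@RGenOInfty.G R) (fun n => `]- n%:R, +oo[%classic)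
  _ _ _ _ (pushforward nu inv) m2' _ _ A mA.
apply.
- exact: RGenOInfty.measurableE.
- move=> _ _ [x ->] [y ->]; exists (Num.max x y).
  by apply/seteqP; split => z /=; rewrite !in_itv /= !andbT gt_max => /andP.
- by move=> n; exists (- n%:R).
- apply/seteqP; split => // x _; exists (Num.truncn `|x|).+1 => //=.
  rewrite in_itv /= andbT ltrNl (le_lt_trans _ (truncnS_gt _)) //.
  by rewrite -normrN ler_norm.
- move=> _ [x ->]; rewrite -[LHS]/(nu (@GRing.inv R @^-1` `]x, +oo[%classic)).
  rewrite -[RHS]/(\int[mu]_(y in `]x, +oo[) (k y)%:E)%E nuE; last first.
    by apply: m_inv; exact: measurable_itv.
  (* Both [h] and [k] vanish on the nonpositive reals, so a ray with negative endpoint may be cut at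
     $0$, where [integral_inv_oy] applies. *)
  have m0 : 0 <= Num.max x 0 by rewrite le_max lexx orbT.
  transitivity (\int[mu]_(y in [set y | 0 < y /\ Num.max x 0 < y^-1]%R) (h y)%:E)%E.
    rewrite integral_mkcond [RHS]integral_mkcond; apply: eq_integral => y _.
    rewrite !patchE; have [y0|y0] := leP y 0.
      by rewrite hN //; do 2 case: ifP.
    congr (if _ then _ else _); apply/idP/idP; rewrite !inE /= in_itv /= andbT gt_max.
      by move=> ->; rewrite invr_gt0 y0.
    by move=> [_ /andP[]].
  rewrite integral_inv_oy // integral_mkcond [RHS]integral_mkcond.
  apply: eq_integral => y _; rewrite !patchE; have [y0|y0] := leP y 0.
    by rewrite kN //; do 2 case: ifP.
  congr (if _ then _ else _).
  by apply/idP/idP; rewrite !inE /= !in_itv /= !andbT gt_max y0 andbT.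
- move=> n; rewrite -[ltLHS]/(nu (@GRing.inv R @^-1` `]- n%:R, +oo[%classic)).
  by rewrite (le_lt_trans _ nuoo) // le_measure ?inE //; exact: m_inv.
Qed.

End inversion_density.

(** * The law $GIG(\lambda,a,a)$: inversion and moments *)

Section gig.
Context (R : realType) (lambda a : R).
Local Notation mu := (@lebesgue_measure R).
Local Notation f := (gig_pdf lambda a).

Let C := (2 * macdonald lambda (a ^+ 2))^-1.
Let e (x : R) := C * x `^ (lambda - 1) * expR (- (a ^+ 2 / 2) * (x + x^-1)).

Lemma gig_pdf_ge0 x : 0 <= f x.
Proof.
rewrite /gig_pdf; case: ifP => // x0.
rewrite mulr_ge0 ?expR_ge0 // mulr_ge0 ?powR_ge0 // invr_ge0 mulr_ge0 //.
rewrite mulr_ge0 ?invr_ge0 //; apply: Rintegral_ge0 => y _.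
by rewrite mulr_ge0 ?expR_ge0 ?powR_ge0.
Qed.

Lemma gig_pdf_le0 x : x <= 0 -> f x = 0.
Proof. by rewrite /gig_pdf leNgt => /negPf ->. Qed.

Lemma measurable_gig_pdf : measurable_fun setT f.
Proof.
apply: (@measurable_fun_ifT _ _ _ _ e (cst 0)) => //.
  by apply: measurable_fun_ltr => //; exact: measurable_cst.
apply: measurable_funM; first by apply: measurable_funM => //; exact: measurable_powR.
apply: measurableT_comp; first exact: measurable_expR.
apply: measurable_funM => //; apply: measurable_funD => //; exact: measurable_fun_inv.
Qed.

Lemma continuous_gig_pdf : {in `]0, +oo[, continuous f}.
Proof.
move=> x; rewrite in_itv /= andbT => x0; have xn0 := lt0r_neq0 x0.
have : e y @[y --> x] --> e x.
  apply: cvgM.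
    apply: cvgM; first exact: cvg_cst.
    have : {for x, continuous (fun y : R => y `^ (lambda - 1))}; last by [].
    apply: differentiable_continuous; apply/derivable1_diffP.
    by apply: derivable_powR; rewrite in_itv /= andbT.
  apply: (cvg_comp _ (@expR R)); last exact: continuous_expR.
  by apply: cvgM; [exact: cvg_cst|apply: cvgD => //; exact: inv_continuous].
have -> : e x = f x by rewrite /gig_pdf x0.
apply: cvg_trans; apply: near_eq_cvg; near=> y.
by rewrite /gig_pdf ifT //; near: y; exact: lt_nbhsr.
Unshelve. all: end_near. Qed.

(** Inversion preserves $x + 1/x$, so only powers change: $x^{1-\lambda} x^{-2} = x^{-2\lambda}
    x^{\lambda-1}$. For $x \le 0$ both sides vanish. *)
Lemma gig_pdf_inv x : f x^-1 * x ^- 2 = x `^ (- (2 * lambda)) * f x.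
Proof.
have [x0|x0] := leP x 0.
  by rewrite !gig_pdf_le0 ?invr_le0 // mul0r mulr0.
rewrite /gig_pdf invr_gt0 x0 invrK [x^-1 + x]addrC.
have -> : x^-1 `^ (lambda - 1) = x `^ (1 - lambda).
  by rewrite -powR_inv1 ?ltW // -powRrM mulN1r opprB.
have -> : x ^- 2 = x `^ (- 2) by rewrite powRN powR_mulrn // ltW.
have p r s : x `^ r * x `^ s = x `^ (r + s).
  by rewrite -powRD //; apply/implyP => _; rewrite lt0r_neq0.
rewrite mulrAC -[_ * x `^ (-2)]mulrA p mulrCA !mulrA -[x `^ _ * _ * _]mulrAC p mulrC.
have -> : 1 - lambda + -2 = - (2 * lambda) + (lambda - 1) by ring.
by rewrite mulrA [_^-1 * _]mulrC; ring.
Qed.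

Context d (T : measurableType d) (P : probability T R) (X : {RV P >-> R}).
Hypothesis X_gig : gig_law lambda a X.

Let nuT : (distribution P X setT < +oo)%E.
Proof. by rewrite (le_lt_trans (probability_le1 _ _)) // ltry. Qed.

Lemma gig_inv_law A : measurable A ->
  distribution P X (@GRing.inv R @^-1` A) =
  (\int[mu]_(x in A) (x `^ (- (2 * lambda)) * f x)%:E)%E.
Proof.
move=> mA; rewrite (density_inv measurable_gig_pdf gig_pdf_ge0 gig_pdf_le0
  continuous_gig_pdf nuT X_gig) //.
by apply: eq_integral => x _; rewrite gig_pdf_inv.
Qed.

Lemma gig_expectation (g : R -> \bar R) : measurable_fun setT g ->
  (forall x, (0 <= g x)%E) ->
  (\int[P]_w g (X w) = \int[mu]_x (g x * (f x)%:E))%E.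
Proof.
move=> mg g0.
have mX : measurable_fun setT (X : T -> measurableTypeR R).
  by move=> _ Y mY; rewrite setTI; exact: (measurable_funPTI X mY).
pose X' : {mfun T >-> measurableTypeR R} :=
  HB.pack (X : T -> measurableTypeR R) (isMeasurableFun.Build _ _ _ _ _ mX).
have mg' : measurable_fun setT (g : measurableTypeR R -> \bar R) by exact: mg.
have mf' : measurable_fun setT (f : measurableTypeR R -> R).
  exact: measurable_gig_pdf.
have nuE A : measurable A -> pushforward P X' A = (\int[mu]_(x in A) (f x)%:E)%E.
  exact: X_gig.
rewrite -(ge0_integral_density mf' gig_pdf_ge0 nuE mg' g0).
by rewrite ge0_integral_pushforward.
Qed.

Lemma gig_gt0 : {ae P, forall w, 0 < X w}.
Proof.
have mA : measurable (`]-oo, 0%R]%classic : set R) by exact: measurable_itv.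
exists (X @^-1` `]-oo, 0%R]%classic); split.
- exact: (measurable_funPTI X mA).
- transitivity (distribution P X `]-oo, 0%R]%classic) => //.
  rewrite X_gig // integral0_eq // => x /=; rewrite in_itv /= => x0.
  by rewrite gig_pdf_le0.
- by move=> w /= /negP; rewrite in_itv /= -leNgt.
Qed.

(** A law with a density charges no point. The point $1$ matters as the only positive solution of
    $x^{-\lambda} = 1$ when $\lambda \ne 0$. *)
Lemma gig_neq1 : {ae P, forall w, X w != 1}.
Proof.
have mA : measurable ([set 1] : set R) by exact: measurable_set1.
exists (X @^-1` [set 1]); split.
- exact: (measurable_funPTI X mA).
- transitivity (distribution P X [set 1]) => //.
  by rewrite X_gig // integral_set1.
- by move=> w /= /negP; rewrite negbK => /eqP.
Qed.

Lemma gig_inv_law0 A : lambda = 0 -> measurable A ->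
  distribution P X (@GRing.inv R @^-1` A) = distribution P X A.
Proof.
move=> l0 mA; rewrite gig_inv_law // X_gig //; apply: eq_integral => x _.
by rewrite l0 mulr0 oppr0 powRr0 mul1r.
Qed.

Let mXpow r : measurable_fun setT (fun w => X w `^ r).
Proof. by apply: (measurableT_comp (measurable_powR r)); exact: measurable_funPT. Qed.

(** By [gig_inv_law] this moment is the total mass of the law of the inverse of [X]. *)
Lemma gig_moment_2 : (\int[P]_w (X w `^ (- (2 * lambda)))%:E = 1)%E.
Proof.
rewrite (gig_expectation (g := fun x => (x `^ (- (2 * lambda)))%:E)).
- have mT : measurable [set: R] by exact: measurableT.
  have := gig_inv_law mT.
  rewrite -[LHS]/(distribution P X setT) probability_setT => ->.
  by apply: eq_integral => x _; rewrite EFinM.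
- by apply/measurable_EFinP; exact: measurable_powR.
- by move=> x; rewrite lee_fin powR_ge0.
Qed.

(** Let $u = X^{-\lambda}$. As $E u^2 = 1$, one has $E (1-u)^2 = 2 - 2 E u$. If $E u \ge 1$ this is
    zero, so $u = 1$ and then $X = 1$ almost surely, against [gig_neq1]. *)
Lemma gig_moment_lt1 : lambda != 0 -> (\int[P]_w (X w `^ (- lambda))%:E < 1)%E.
Proof.
move=> l0; pose u w := X w `^ (- lambda).
have mu1 : measurable_fun setT u by exact: mXpow.
have u0 w : 0 <= u w by exact: powR_ge0.
have u2 w : u w ^+ 2 = X w `^ (- (2 * lambda)).
  by rewrite /u -powR_mulrn ?powR_ge0 // -powRrM mulNr mulrC.
rewrite ltNge; apply/negP => Eu.
(* A sum of nonnegative integrals instead of a difference, so that additivity holds in the extended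
   reals. *)
have Esum : (\int[P]_w ((1 - u w) ^+ 2)%:E + \int[P]_w (2 * u w)%:E = 2%:E)%E.
  rewrite -ge0_integralD //; last 4 first.
  - by move=> w _; rewrite lee_fin sqr_ge0.
  - apply/measurable_EFinP; apply: measurable_funX; exact: measurable_funB.
  - by move=> w _; rewrite lee_fin mulr_ge0.
  - by apply/measurable_EFinP; exact: measurable_funM.
  transitivity (\int[P]_w (1%:E + (u w ^+ 2)%:E))%E.
    by apply: eq_integral => w _; rewrite -!EFinD; congr EFin; ring.
  rewrite ge0_integralD //; last 2 first.
  - by move=> w _; rewrite lee_fin sqr_ge0.
  - by apply/measurable_EFinP; exact: measurable_funX.
  rewrite integral_cst // mul1e -[X in (X + _)%E]/(P setT) (@probability_setT _ _ _ P).
  under eq_integral do rewrite u2.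
  by rewrite gig_moment_2 -EFinD.
have Esq : (\int[P]_w ((1 - u w) ^+ 2)%:E = 0)%E.
  have E2 : (2%:E <= \int[P]_w (2 * u w)%:E)%E.
    under eq_integral do rewrite EFinM.
    rewrite ge0_integralZl_EFin //; last 2 first.
    - by move=> w _; rewrite lee_fin.
    - exact/measurable_EFinP.
    by rewrite -[leLHS]mule1 lee_pmul2l.
  have I0 : (0 <= \int[P]_w ((1 - u w) ^+ 2)%:E)%E.
    by apply: integral_ge0 => w _; rewrite lee_fin sqr_ge0.
  apply/eqP; rewrite eq_le I0 andbT.
  by rewrite -(@leeD2rE _ 2%:E) // add0e -[leRHS]Esum leeD2l.
have mI : measurable_fun setT (fun w => ((1 - u w) ^+ 2)%:E).
  by apply/measurable_EFinP; apply: measurable_funX; exact: measurable_funB.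
have ae1 : {ae P, forall w, ((1 - u w) ^+ 2)%:E = 0%E}.
  have := (ae_eq_integral_abs P measurableT mI).1.
  under eq_integral do rewrite gee0_abs ?lee_fin ?sqr_ge0 //.
  move=> /(_ Esq); apply: filterS => w; exact.
have : {ae P, forall w : T, False}.
  apply: filterS3 ae1 gig_gt0 gig_neq1 => w [] /eqP.
  rewrite sqrf_eq0 subr_eq0 => /eqP u1 Xw0 /eqP; apply.
  have : u w `^ (- lambda^-1) = 1 by rewrite -u1 powR1.
  by rewrite /u -powRrM mulrNN divff // powRr1 // ltW.
move=> [N [mN PN sub]].
have : (P setT <= P N)%E by apply: le_measure; rewrite ?inE // => w _; exact: sub.
by rewrite PN probability_setT lee_fin ler10.
Qed.

End gig.

(** * The space of paths with its cylinder $\sigma$-algebra *)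

Section sequence_space.
Context (R : realType).

(** A single family [B] over all indices, trivial from [n] on, lets intersections be taken
    coordinatewise, so that cylinders form a $\pi$-system. *)
Definition cylinder : set (set (nat -> R)) :=
  [set C | exists n (B : nat -> set R), [/\ forall i, measurable (B i),
    forall i, (n <= i)%N -> B i = setT & C = [set g | forall i, B i (g i)]]].

Local Notation seqT := (g_sigma_algebraType cylinder).

Lemma cylinderT : cylinder setT.
Proof.
exists 0%N, (fun=> setT); split=> //; exact/seteqP.
Qed.

Lemma cylinderI : setI_closed cylinder.
Proof.
move=> _ _ [n [B [mB BT ->]]] [m [B' [mB' BT' ->]]].
exists (maxn n m), (fun i => B i `&` B' i); split.
- by move=> i; exact: measurableI.
- by move=> i; rewrite geq_max => /andP[ni mi]; rewrite BT // BT' // setTI.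
- by apply/seteqP; split => g /= => [[gB gB'] i|gBB']; [|split=> i; case: (gBB' i)].
Qed.

Lemma measurable_coord i : measurable_fun [set: seqT] (fun g : seqT => (g : nat -> R) i).
Proof.
move=> _ Y mY; rewrite setTI; apply: sub_sigma_algebra.
exists i.+1, (fun j => if j == i then Y else setT); split.
- by move=> j; case: ifP.
- by move=> j ij; rewrite gtn_eqF.
- apply/seteqP; split => g /= => [gY j|/(_ i)]; last by rewrite eqxx.
  by case: eqP => [->|].
Qed.

Context d (T : measurableType d).

Lemma measurable_seq (Y : T -> seqT) :
  (forall i, measurable_fun setT (fun w => (Y w : nat -> R) i)) ->
  measurable_fun setT Y.
Proof.
move=> mY; apply: (@measurability _ _ _ seqT setT Y cylinder) => // _ [_ [n [B [mB _ ->]]] <-].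
rewrite setTI (_ : _ @^-1` _ = \bigcap_i ((fun w => (Y w : nat -> R) i) @^-1` B i)).
  by apply: bigcapT_measurable => i; rewrite -[X in measurable X]setTI; exact: mY.
by apply/seteqP; split => w /= YB i; [move=> _; exact: YB|exact: (YB i I)].
Qed.

Context (P : probability T R).

Lemma law_unique (Y Y' : {mfun T >-> seqT}) :
  (forall C, cylinder C -> P (Y @^-1` C) = P (Y' @^-1` C)) ->
  forall E : set seqT, measurable E -> P (Y @^-1` E) = P (Y' @^-1` E).
Proof.
move=> YY' E mE.
have := @measure_unique _ R seqT cylinder (fun=> setT) erefl cylinderI
  (fun=> cylinderT) _ (distribution P Y) (distribution P Y') YY' _ E mE.
apply.
- exact: bigcup_const.
- by move=> _; rewrite -[ltLHS]/(P (Y @^-1` setT)) preimage_setT probability_setT ltry.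
Qed.

(** In [E] the two sides are finite measures: the image under [Y] of [P] restricted to [A], and the
    law of [Y] scaled by [P A]. Agreement on the $\pi$-system of cylinders suffices. *)
Lemma event_indep_unique (A : set T) (Y : {mfun T >-> seqT}) : measurable A ->
  (forall C, cylinder C -> P (A `&` Y @^-1` C) = (P A * P (Y @^-1` C))%E) ->
  forall E : set seqT, measurable E ->
  P (A `&` Y @^-1` E) = (P A * P (Y @^-1` E))%E.
Proof.
move=> mA AY E mE.
have PA0 : 0 <= fine (P A) by rewrite fine_ge0.
have PAE : (P A = (fine (P A))%:E) by rewrite fineK // fin_num_measure.
pose m2 := mscale (NngNum PA0) (distribution P Y).
have m2E B : m2 B = (P A * P (Y @^-1` B))%E by rewrite [in RHS]PAE.
rewrite setIC -m2E.
have := @measure_unique _ R seqT cylinder (fun=> setT) erefl cylinderI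
  (fun=> cylinderT) _ (pushforward (mrestr P mA) Y) m2 _ _ E mE.
apply.
- exact: bigcup_const.
- by move=> C cC; rewrite -[LHS]/(P (Y @^-1` C `&` A)) setIC AY //.
- move=> _; rewrite -[ltLHS]/(P (Y @^-1` setT `&` A)).
  by rewrite preimage_setT setTI (le_lt_trans (probability_le1 P _)) ?ltry.
Qed.

(** [event_indep_unique] is applied twice, passing from cylinders to measurable sets in one factor
    at a time. *)
Lemma seq_indep_unique (Y Y' : {mfun T >-> seqT}) :
  (forall C D, cylinder C -> cylinder D ->
    P (Y @^-1` C `&` Y' @^-1` D) = (P (Y @^-1` C) * P (Y' @^-1` D))%E) ->
  forall E F : set seqT, measurable E -> measurable F ->
  P (Y @^-1` E `&` Y' @^-1` F) = (P (Y @^-1` E) * P (Y' @^-1` F))%E.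
Proof.
move=> YY' E F mE mF; apply: event_indep_unique => //.
  exact: measurable_funPTI.
move=> D cD; rewrite setIC muleC; apply: event_indep_unique => //.
  by apply: measurable_funPTI; exact: sub_sigma_algebra.
by move=> C cC; rewrite setIC muleC YY'.
Qed.

End sequence_space.

Section path_rv.
Context (R : realType) d (T : measurableType d).
Local Notation seqT := (g_sigma_algebraType (@cylinder R)).

(* [mY] does not occur in the body: it lets the instance below be inferred. *)
Definition path_rv (Y : nat -> T -> R) (mY : forall i, measurable_fun setT (Y i)) :
  T -> seqT := fun w i => Y i w.

HB.instance Definition _ Y (mY : forall i, measurable_fun setT (Y i)) :=
  isMeasurableFun.Build _ _ _ _ (path_rv mY) (measurable_seq (Y := path_rv mY) mY).

End path_rv.

(** * Blocks, shifts and inversion of an i.i.d. sequence with common law [q] *)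

Section iid.
Context (R : realType) d (T : measurableType d) (P : probability T R).
Local Notation seqT := (g_sigma_algebraType (@cylinder R)).
Variables (gamma : nat -> {RV P >-> R}) (q : set R -> \bar R).
Hypothesis gamma_indep : independent_seq gamma.
Hypothesis gamma_id : forall n A, measurable A -> P (gamma n @^-1` A) = q A.

Let q_setT : q setT = 1%E.
Proof. by rewrite -(gamma_id 0 measurableT) preimage_setT probability_setT. Qed.

(** The two blocks form one rectangle over the indices below $n + m$, whose sides come from [B] and
    then, shifted by $n$, from [B']. *)
Lemma block_law n m (B B' : nat -> set R) :
  (forall i, measurable (B i)) -> (forall i, measurable (B' i)) ->
  P ([set w | forall i, (i < n)%N -> B i (gamma i w)] `&`
     [set w | forall j, (j < m)%N -> B' j (gamma (n + j)%N w)]) =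
  ((\prod_(i <- iota 0 n) q (B i)) * (\prod_(j <- iota 0 m) q (B' j)))%E.
Proof.
move=> mB mB'; pose A i := if (i < n)%N then B i else B' (i - n)%N.
have mA i : measurable (A i) by rewrite /A; case: ifP.
have := gamma_indep (iota_uniq 0 (n + m)) mA.
rewrite [X in P X = _ -> _](_ : _ = [set w | forall i, (i < n)%N -> B i (gamma i w)] `&`
     [set w | forall j, (j < m)%N -> B' j (gamma (n + j)%N w)]).
  move=> ->; rewrite iotaD big_cat /= -[n in iota n m]addn0 iotaDl big_map.
  congr (_ * _)%E; apply: eq_big_seq => i.
    by rewrite mem_iota add0n => /andP[_ ilt]; rewrite gamma_id // /A ilt.
  by move=> _; rewrite gamma_id // /A addKn ltnNge leq_addr.
apply/seteqP; split => w /=.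
  move=> Aw; split => i im.
    have : [set` iota 0 (n + m)] i by rewrite /= mem_iota /= add0n ltn_addr.
    by move=> /Aw; rewrite /A /= im.
  have : [set` iota 0 (n + m)] (n + i)%N by rewrite /= mem_iota /= add0n ltn_add2l.
  by move=> /Aw; rewrite /A /= addKn ltnNge leq_addr.
move=> [Bw B'w] i /=; rewrite mem_iota /= add0n => im; rewrite /A /preimage /=.
case: ltnP => ni; first exact: Bw.
by have := B'w (i - n)%N; rewrite subnKC //; apply; rewrite ltn_subLR.
Qed.

Let mgamma i : measurable_fun setT (gamma i).
Proof. exact: measurable_funPT. Qed.

Lemma block_lawl n (B : nat -> set R) : (forall i, measurable (B i)) ->
  P [set w | forall i, (i < n)%N -> B i (gamma i w)] = (\prod_(i <- iota 0 n) q (B i))%E.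
Proof.
move=> mB; have := @block_law n 0 B (fun=> setT) mB (fun=> measurableT).
rewrite big_nil mule1 => <-; congr (P _).
by apply/seteqP; split => w //= [].
Qed.

Lemma block_lawr n m (B : nat -> set R) : (forall i, measurable (B i)) ->
  P [set w | forall j, (j < m)%N -> B j (gamma (n + j)%N w)] =
  (\prod_(i <- iota 0 m) q (B i))%E.
Proof.
move=> mB; have := @block_law n m (fun=> setT) B (fun=> measurableT) mB.
rewrite [in RHS]big1 ?mul1e => [<-|i _]; last exact: q_setT.
by congr (P _); apply/seteqP; split => w //= [].
Qed.

Let mshift n i : measurable_fun setT (gamma (n + i)%N).
Proof. exact: measurable_funPT. Qed.

(** The past before time $n$, padded with $0$ into a full path so that past and future live in the
    same space. *)
Let trunc n i w := if (i < n)%N then gamma i w else 0.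

Let mtrunc n i : measurable_fun setT (trunc n i).
Proof. by rewrite /trunc; case: (i < n)%N. Qed.

Let cylinderE n (B : nat -> set R) (Y : nat -> T -> R) :
  (forall i, (n <= i)%N -> B i = setT) ->
  [set w | forall i, B i (Y i w)] = [set w | forall i, (i < n)%N -> B i (Y i w)].
Proof.
move=> BT; apply/seteqP; split => w /= Bw i; first by move=> _; exact: Bw.
by have [/Bw//|/BT->] := ltnP i n.
Qed.

Lemma law_shift n (E : set seqT) : measurable E ->
  P [set w | E (fun i => gamma (n + i)%N w)] = P [set w | E (fun i => gamma i w)].
Proof.
apply: (law_unique (P := P) (Y := path_rv (mshift n)) (Y' := path_rv mgamma)).
move=> _ [m [B [mB BT ->]]].
rewrite /preimage /path_rv /= (cylinderE (fun i => gamma (n + i)%N) BT).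
rewrite (cylinderE (fun i => gamma i) BT).
by rewrite block_lawl // (block_lawr n m mB).
Qed.

Lemma law_inv (E : set seqT) :
  (forall A, measurable A -> q (@GRing.inv R @^-1` A) = q A) -> measurable E ->
  P [set w | E (fun i => (gamma i w)^-1)] = P [set w | E (fun i => gamma i w)].
Proof.
move=> qV; have minv i : measurable_fun setT (fun w => (gamma i w)^-1).
  exact: (measurableT_comp (@measurable_fun_inv R) (mgamma i)).
apply: (law_unique (P := P) (Y := path_rv minv) (Y' := path_rv mgamma)).
move=> _ [m [B [mB BT ->]]].
rewrite /preimage /path_rv /= (cylinderE (fun i w => (gamma i w)^-1) BT).
rewrite (cylinderE (fun i => gamma i) BT).
rewrite block_lawl // (block_lawl m (B := fun i => @GRing.inv R @^-1` B i)); last first.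
  move=> i; rewrite -[X in measurable X]setTI.
  exact: (@measurable_fun_inv R measurableT _ (mB i)).
by apply: eq_bigr => i _; exact: qV.
Qed.

(** By [law_shift] the future has the law of the whole path; independence is checked on cylinders,
    where it comes from [block_law]. *)
Lemma indep_past_future n (E F : set seqT) : measurable E -> measurable F ->
  P ([set w | E (fun i => trunc n i w)] `&` [set w | F (fun i => gamma (n + i)%N w)]) =
  (P [set w | E (fun i => trunc n i w)] * P [set w | F (fun i => gamma i w)])%E.
Proof.
move=> mE mF; rewrite -(law_shift n mF); move: E F mE mF.
apply: (seq_indep_unique (P := P) (Y := path_rv (mtrunc n)) (Y' := path_rv (mshift n))).
move=> _ _ [m [B [mB BT ->]]] [m' [B' [mB' BT' ->]]].
rewrite /preimage /path_rv /= (cylinderE (fun i => gamma (n + i)%N) BT').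
(* From index $n$ on the truncated path is $0$: either the cylinder accepts $0$ there and only
   constrains the first $n$ factors, or its preimage is empty. *)
have [Bn|/existsNP[i /not_implyP[ni Bi]]] := pselect (forall i, (n <= i)%N -> B i 0).
  have -> : [set w | forall i, B i (trunc n i w)] =
            [set w | forall i, (i < n)%N -> B i (gamma i w)].
    apply/seteqP; split => w /= Bw i.
      by move=> ilt; have := Bw i; rewrite /trunc ilt.
    by rewrite /trunc; case: ltnP => [/Bw//|/Bn].
  by rewrite block_law // block_lawl // block_lawr.
have -> : [set w | forall i, B i (trunc n i w)] = set0.
  by apply/seteqP; split => w //= /(_ i); rewrite /trunc ltnNge ni.
by rewrite set0I measure0 mul0e.
Qed.

End iid.

Lemma sum_expr_le (R : realType) (x : R) n : 0 < x < 1 ->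
  \sum_(0 <= k < n) x ^+ k <= (1 - x)^-1.
Proof.
move=> /andP[x0 x1]; have nx1 : `|x| < 1 by rewrite ger0_norm // ltW.
rewrite -[leRHS]mul1r; apply: le_trans (geometric_le_lim n ler01 x0 nx1).
by apply: ler_sum => k _; rewrite /= mul1r.
Qed.

(** * Geometric decay of products of i.i.d. nonnegative factors with mean below $1$ *)

Section product_expectation.
Context (R : realType) d (T : measurableType d) (P : probability T R).
Local Notation seqT := (g_sigma_algebraType (@cylinder R)).
Variables (gamma : nat -> {RV P >-> R}) (q : set R -> \bar R).
Hypothesis gamma_indep : independent_seq gamma.
Hypothesis gamma_id : forall n A, measurable A -> P (gamma n @^-1` A) = q A.
Variables (f : R -> R) (r : R).
Hypotheses (mf : measurable_fun setT f) (f0 : forall x, 0 <= f x).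
Hypothesis Ef : forall n, (\int[P]_w (f (gamma n w))%:E = r%:E)%E.

Let u n w := \prod_(0 <= i < n) f (gamma i w).

Let u0 n w : 0 <= u n w.
Proof. by apply: prodr_ge0. Qed.

Let mfgamma i : measurable_fun setT (fun w => f (gamma i w)).
Proof. by apply: (measurableT_comp mf); exact: measurable_funPT. Qed.

Let measurable_u n : measurable_fun setT (u n).
Proof. by apply: measurable_prod => i _; exact: mfgamma. Qed.

(** [u n] is a function of the path truncated at $n$, and [gamma n] is the initial coordinate of the
    path shifted by $n$. *)
Let indep_u n (A B : set R) : measurable A -> measurable B ->
  P (u n @^-1` A `&` gamma n @^-1` B) = (P (u n @^-1` A) * P (gamma n @^-1` B))%E.
Proof.
move=> mA mB.
pose E : set seqT := [set g | A (\prod_(0 <= i < n) f ((g : nat -> R) i))].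
pose F : set seqT := [set g | B ((g : nat -> R) 0%N)].
have mE : measurable E.
  have mp : measurable_fun [set: seqT] (fun g => \prod_(0 <= i < n) f ((g : nat -> R) i)).
    by apply: measurable_prod => i _; apply: (measurableT_comp mf); exact: measurable_coord.
  by have := mp measurableT _ mA; rewrite setTI.
have mF : measurable F.
  by have := @measurable_coord R 0 measurableT _ mB; rewrite setTI.
have := indep_past_future gamma_indep gamma_id n mE mF.
have -> : [set w | E (fun i => if (i < n)%N then gamma i w else 0)] = u n @^-1` A.
  have e w : \prod_(0 <= i < n) f (if (i < n)%N then gamma i w else 0) = u n w.
    by apply: eq_big_nat => i /andP[_ ->].
  by apply/seteqP; split=> w; rewrite /E /= e.
have -> : [set w | F (fun i => gamma (n + i)%N w)] = gamma n @^-1` B.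
  by apply/seteqP; split=> w; rewrite /F /= addn0.
by move=> ->; congr (_ * _)%E; rewrite gamma_id // -(gamma_id 0%N mB).
Qed.

(** By [indep_u] the joint law of [u n] and [gamma n] is a product measure; Tonelli then splits off
    one factor [r] at each induction step. *)
Lemma expectation_prod n :
  (\int[P]_w (\prod_(0 <= i < n) f (gamma i w))%:E = (r ^+ n)%:E)%E.
Proof.
elim: n => [|n IH].
  under eq_integral do rewrite big_geq //.
  by rewrite integral_cst // mul1e expr0; exact: probability_setT.
pose U : {mfun T >-> R} := HB.pack (u n) (isMeasurableFun.Build _ _ _ _ _ (measurable_u n)).
have mZ : measurable_fun setT (fun w => (u n w, gamma n w)).
  by apply/measurable_fun_pairP; split; [exact: measurable_u|exact: (measurable_funPT (gamma n))].
pose Z : {mfun T >-> (R * R)%type} := HB.pack (fun w => (u n w, gamma n w))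
  (isMeasurableFun.Build _ _ _ _ _ mZ).
(* The absolute value makes [F] nonnegative on the whole plane and leaves the nonnegative [u n]
   unchanged. *)
pose F (z : R * R) : \bar R := (`|z.1| * f z.2)%:E.
have mF : measurable_fun setT F.
  apply/measurable_EFinP; apply: measurable_funM.
    by apply: measurableT_comp => //; exact: measurable_fst.
  by apply: (measurableT_comp mf); exact: measurable_snd.
have F0 z : (0 <= F z)%E by rewrite lee_fin mulr_ge0.
transitivity (\int[distribution P Z]_z F z)%E.
  rewrite ge0_integral_distribution //; apply: eq_integral => w _.
  by rewrite /F /= big_nat_recr //= ger0_norm // u0.
transitivity (\int[distribution P U \x distribution P (gamma n)]_z F z)%E.
  apply: eq_measure_integral => A mA _; apply: esym.
  apply: (@product_measure_unique _ _ _ _ _ (distribution P U)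
    (distribution P (gamma n)) (distribution P Z)) => // B C mB mC.
  exact: indep_u.
rewrite fubini_tonelli1 //.
transitivity (\int[distribution P U]_x (`|x| * r)%:E)%E.
  apply: eq_integral => x _; rewrite /fubini_F /F /=.
  under eq_integral do rewrite EFinM.
  rewrite ge0_integralZl_EFin //; last 2 first.
  - by move=> y _; rewrite lee_fin.
  - exact/measurable_EFinP.
  rewrite (ge0_integral_distribution (gamma n) (f := EFin \o f)) //; last first.
  - exact/measurable_EFinP.
  by rewrite Ef EFinM.
have r0 : 0 <= r by rewrite -lee_fin -(Ef 0); apply: integral_ge0 => w _; rewrite lee_fin.
rewrite (ge0_integral_distribution U (f := fun x => (`|x| * r)%:E)) /=; last 2 first.
- by apply/measurable_EFinP; apply: measurable_funM => //.
- by move=> y; rewrite lee_fin mulr_ge0.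
transitivity (\int[P]_w (r%:E * (u n w)%:E))%E.
  by apply: eq_integral => w _; rewrite /= ger0_norm // EFinM muleC.
rewrite ge0_integralZl_EFin //; last 2 first.
- by move=> y _; rewrite lee_fin.
- exact/measurable_EFinP.
by rewrite IH exprS EFinM.
Qed.

(** Markov's inequality bounds $P(u_n \ge \rho^n)$ by $r^n/\rho^n$, which is at most $\rho^n$ if $r
    \le \rho^2$; Borel-Cantelli concludes. *)
Lemma prod_geometric_decay : r < 1 ->
  exists2 rho : R, 0 < rho < 1 &
  {ae P, forall w, \forall n \near \oo, \prod_(0 <= i < n) f (gamma i w) < rho ^+ n}.
Proof.
(* The midpoint of $r$ and $1$ satisfies $r \le \rho^2$ because $(1+r)^2 - 4r = (1-r)^2$. *)
move=> r1; pose rho := (1 + r) / 2.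
have r0 : 0 <= r by rewrite -lee_fin -(Ef 0); apply: integral_ge0 => w _; rewrite lee_fin.
have rho0 : 0 < rho by rewrite /rho; lra.
have rho1 : rho < 1 by rewrite /rho; lra.
have rrho : r <= rho ^+ 2 by rewrite /rho; nra.
exists rho; first by rewrite rho0.
pose F n := [set w | rho ^+ n <= u n w].
have mF n : measurable (F n).
  rewrite -[F n]setTI; apply: measurable_fun_ler => //.
have PF n : (P (F n) <= (rho ^+ n)%:E)%E.
  have rn0 : 0 < rho ^+ n by rewrite exprn_gt0.
  have := @le_integral_abse _ _ _ P setT measurableT (EFin \o u n) _
    (proj2 (measurable_EFinP _ _) (measurable_u n)) rn0.
  have -> : [set: T] `&` [set x | ((rho ^+ n)%:E <= `|(EFin \o u n) x|)%E] = F n.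
    by rewrite setTI; apply/seteqP; split=> w; rewrite /F /= lee_fin ger0_norm // u0.
  under eq_integral do rewrite /= ger0_norm ?u0 //.
  rewrite expectation_prod => H.
  rewrite -(@lee_pmul2l _ (rho ^+ n)%:E) ?lte_fin // (le_trans H) //.
  by rewrite -EFinM lee_fin -expr2 exprAC lerXn2r ?nnegrE ?sqr_ge0.
have sumF : (\sum_(n <oo) P (F n) < +oo)%E.
  apply: (@le_lt_trans _ _ ((1 - rho)^-1)%:E); last exact: ltry.
  apply: lime_le; first by apply: is_cvg_nneseries => *; exact: measure_ge0.
  apply: nearW => n; apply: (@le_trans _ _ (\sum_(0 <= k < n) (rho ^+ k)%:E)%E).
    by apply: lee_sum => k _; exact: PF.
  by rewrite sumEFin lee_fin sum_expr_le // rho0.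
have Plim := lim_sup_set_cvg0 mF sumF.
exists (lim_sup_set F); split => //.
  by apply: bigcap_measurable => // n _; apply: bigcup_measurable => k _; exact: mF.
move=> w nw; apply: contrapT => wF; apply: nw => /=.
have [n nF] : exists n, ~ (\bigcup_(j >= n) F j) w.
  by apply/existsNP => wF'; apply: wF => n _; exact: wF'.
exists n => // k /= nk; rewrite ltNge; apply/negP => Fk; apply: nF.
by exists k.
Qed.

End product_expectation.

(** * Growth of $N_n$ along a positive path *)

Section path_growth.
Context (R : realType) (g : nat -> R) (g0 : forall i, 0 < g i).

Let X0 n : 0 < Xseq g n. Proof. exact: Xseq_gt0. Qed.

Let powR1E (r : R) : 1 `^ r = 1. Proof. by rewrite powR1. Qed.

Lemma Xseq_powR r n : Xseq g n `^ r = \prod_(0 <= i < n) g i `^ r.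
Proof.
elim: n => [|n IH]; first by rewrite Xseq0 powR1 big_geq.
by rewrite XseqS big_nat_recr //= powRM ?IH // ltW.
Qed.

(** The hypothesis gives $X_n^{-1} \le q^n$ with $q = \rho^{1/\lambda} < 1$ from time [K] on, so the
    later increments are dominated by a geometric series. *)
Lemma Nseq_bounded (lambda rho : R) : 0 < lambda -> 0 < rho < 1 ->
  (\forall n \near \oo, Xseq g n `^ (- lambda) < rho ^+ n) ->
  has_ubound (range (Nseq g)).
Proof.
move=> l0 /andP[rho0 rho1] [K _ XK]; pose q := rho `^ lambda^-1.
have q0 : 0 < q by exact: powR_gt0.
have q1 : q < 1.
  rewrite /q -[ltRHS](powR1E lambda^-1); apply: gt0_ltr_powR => //.
  - by rewrite invr_gt0.
  - by rewrite nnegrE ltW.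
  - by rewrite nnegrE ler01.
have XV n : (K <= n)%N -> (Xseq g n)^-1 <= q ^+ n.
  move=> /XK /= /ltW XVn; have : (Xseq g n `^ (- lambda)) `^ lambda^-1 <= (rho ^+ n) `^ lambda^-1.
    apply: ge0_ler_powR => //; first by rewrite invr_ge0 ltW.
    - by rewrite nnegrE powR_ge0.
    - by rewrite nnegrE exprn_ge0 // ltW.
  rewrite -powRrM mulNr divff ?lt0r_neq0 // powR_inv1 ?(ltW (X0 _)) //.
  by rewrite -powR_mulrn ?(ltW rho0) // powRAC powR_mulrn ?powR_ge0.
(* The increment bound $q^{K+m} q^{K+m+1}$ is weakened to $q^m$, so that the sum starts at exponent
   $0$. *)
have incr m : Nseq g (K + m) <= Nseq g K + \sum_(0 <= k < m) q ^+ k.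
  elim: m => [|m IH]; first by rewrite addn0 big_geq // addr0.
  rewrite addnS NseqS // big_nat_recr //= addrA lerD // invfM.
  have q01 n : q ^+ n <= 1 by rewrite exprn_ile1 // ltW.
  apply: (@le_trans _ _ (q ^+ (K + m) * q ^+ (K + m).+1)).
    apply: ler_pM; rewrite ?invr_ge0 ?(ltW (X0 _)) //; apply: XV.
      exact: leq_addr.
    by rewrite -addnS leq_addr.
  rewrite (@le_trans _ _ (q ^+ (K + m))) //.
    by rewrite ler_piMr // exprn_ge0 // ltW.
  by rewrite exprD ler_piMl // exprn_ge0 // ltW.
exists (Nseq g K + (1 - q)^-1) => _ [n _ <-].
apply: (@le_trans _ _ (Nseq g (K + n))); first by apply: Nseq_nd => //; exact: leq_addl.
by rewrite (le_trans (incr n)) // lerD2l sum_expr_le // q0.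
Qed.

(** As $-\lambda > 0$, the hypothesis forces $X_n \le 1$ from time [K] on, and each later increment
    is at least $1$. *)
Lemma Nseq_unbounded (lambda rho : R) : lambda < 0 -> 0 < rho < 1 ->
  (\forall n \near \oo, Xseq g n `^ (- lambda) < rho ^+ n) ->
  ~ has_ubound (range (Nseq g)).
Proof.
move=> l0 /andP[rho0 rho1] [K _ XK] [M NM].
have X1 n : (K <= n)%N -> Xseq g n <= 1.
  move=> /XK /= XVn; rewrite leNgt; apply/negP => X1.
  have : Xseq g n `^ (- lambda) < 1 by rewrite (lt_le_trans XVn) // exprn_ile1 // ltW.
  rewrite ltNge => /negP; apply; rewrite -[leLHS](powR1E (- lambda)).
  apply: ge0_ler_powR; rewrite ?nnegrE ?oppr_ge0 // ltW //.
have incr m : m%:R <= Nseq g (K + m).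
  elim: m => [|m IH]; first exact: Nseq_ge0.
  rewrite addnS NseqS // -natr1 lerD // invf_ge1 ?mulr_gt0 //.
  by rewrite mulr_ile1 ?(ltW (X0 _)) ?X1 // ?leq_addr // -addnS leq_addr.
have := le_trans (incr (Num.truncn M).+1) (NM _ (ex_intro2 _ _ _ I erefl)).
by rewrite leNgt truncnS_gt.
Qed.

(** The two increments are $1/x$ and $x$ with $x = X_n X_{n+1}$, and one of them is at least $1$. *)
Lemma Nseq_inv n : n%:R <= Nseq g n + Nseq (fun i => (g i)^-1) n.
Proof.
elim: n => [|n IH]; first by rewrite !Nseq0 addr0.
have gV0 i : 0 < (g i)^-1 by rewrite invr_gt0.
rewrite NseqS // (NseqS n gV0) !XseqV addrACA -natr1 lerD // -(invfM (Xseq g n)) invrK.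
set x := _ * _; have x0 : 0 < x by rewrite mulr_gt0.
have [x1|x1] := leP 1 x; first by rewrite ler_wpDl // invr_ge0 ltW.
by rewrite -[leLHS]addr0 lerD ?(ltW x0) // invf_ge1 // ltW.
Qed.

End path_growth.

(** * Zero-one law for boundedness of $N_n$, and unboundedness under an inversion-invariant law *)

Section zero_one.
Context (R : realType) d (T : measurableType d) (P : probability T R).
Local Notation seqT := (g_sigma_algebraType (@cylinder R)).
Variables (gamma : nat -> {RV P >-> R}) (q : set R -> \bar R).
Hypothesis gamma_indep : independent_seq gamma.
Hypothesis gamma_id : forall n A, measurable A -> P (gamma n @^-1` A) = q A.
Hypothesis gamma_gt0 : {ae P, forall w, forall i, 0 < gamma i w}.

Let path w : nat -> R := fun i => gamma i w.

(** Inclusions valid on positive paths only still compare probabilities, the other paths forming a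
    null set. *)
Let le_ae (A B : set T) : measurable A -> measurable B ->
  (forall w, (forall i, 0 < gamma i w) -> A w -> B w) -> (P A <= P B)%E.
Proof.
move=> mA mB AB; have [N [mN PN sub]] := gamma_gt0.
apply: (@le_trans _ _ (P (B `|` N))).
  apply: le_measure; rewrite ?inE //; first exact: measurableU.
  move=> w Aw; have [pos|npos] := pselect (forall i, 0 < gamma i w).
    by left; exact: AB.
  by right; apply: sub.
rewrite (le_trans (measureU2 _ _ _)) //.
by rewrite [X in (_ + X)%E]PN adde0.
Qed.

(** This event depends on the first $n$ factors only, since $N_k$ involves the indices below $k$. *)
Let E_ n M : set seqT := [set g | forall k, (k <= n)%N -> Nseq g k <= M].

Let measurable_Nseq k : measurable_fun [set: seqT] (fun g => Nseq (g : nat -> R) k).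
Proof.
have mi i : measurable_fun [set: seqT] (fun g : seqT => ((g : nat -> R) i)^-1).
  exact: (measurableT_comp (@measurable_fun_inv R) (@measurable_coord R i)).
rewrite /Nseq; apply: measurable_funM.
  apply: (measurableT_comp (@measurable_fun_inv R)); apply: measurable_prod => i _.
  exact: measurable_coord.
apply: measurable_sum => i; apply: measurable_funM.
  by apply: measurable_prod => j _; exact: mi.
by apply: measurable_prod => j _; exact: measurable_coord.
Qed.

Let mE n M : measurable (E_ n M).
Proof.
rewrite (_ : E_ n M = \bigcap_(k in `I_n.+1) [set g : seqT | Nseq (g : nat -> R) k <= M]).
  apply: bigcap_measurable; first by exists 0%N.
  move=> k _; rewrite -[X in measurable X]setTI.
  by apply: measurable_fun_ler => //; exact: measurable_cst.
by apply/seteqP; split.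
Qed.

(** Integer bounds make this a countable union, hence a measurable set. *)
Let bounded : set seqT := \bigcup_M \bigcap_n E_ n M%:R.

Let mbounded : measurable bounded.
Proof.
by apply: bigcupT_measurable => M; apply: bigcapT_measurable => n; exact: mE.
Qed.

Let boundedP (g : nat -> R) : bounded g <-> has_ubound (range (Nseq g)).
Proof.
split=> [[M _ gM]|[M gM]].
  by exists M%:R => _ [k _ <-]; apply: (gM k).
exists (Num.truncn M).+1 => // n _ k _.
by rewrite (le_trans (gM (Nseq g k) _)) ?(ltW (truncnS_gt _)) //; exists k.
Qed.

(** [NseqD] relates the two sequences by an affine map of positive slope $X_n^{-2}$. *)
Let bounded_shift (g : nat -> R) n : (forall i, 0 < g i) ->
  bounded (fun i => g (n + i)%N) <-> bounded g.
Proof.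
move=> g0; rewrite !boundedP; have X0 := Xseq_gt0 n g0.
have c0 : 0 < (Xseq g n) ^- 2 by rewrite invr_gt0 exprn_gt0.
split=> -[M gM].
  exists (Nseq g n + (Xseq g n) ^- 2 * M) => _ [k _ <-].
  apply: (@le_trans _ _ (Nseq g (n + k))); first by apply: Nseq_nd => //; exact: leq_addl.
  by rewrite NseqD // lerD2l ler_pM2l //; apply: gM; exists k.
exists (M / (Xseq g n) ^- 2) => _ [k _ <-].
rewrite ler_pdivlMr // mulrC (@le_trans _ _ (Nseq g (n + k))) //.
  by rewrite NseqD // ler_wpDl // Nseq_ge0.
by apply: gM; exists (n + k)%N.
Qed.

Let mseq (E : set seqT) (Y : nat -> T -> R) : (forall i, measurable_fun setT (Y i)) ->
  measurable E -> measurable [set w | E (fun i => Y i w)].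
Proof.
move=> mY mE0; exact: (measurable_funPTI (path_rv mY) mE0).
Qed.

Let mgamma i : measurable_fun setT (gamma i : T -> R).
Proof. exact: measurable_funPT. Qed.

Let A_ n M := [set w | E_ n M (path w)].
Let B := [set w | bounded (path w)].

Let mA n M : measurable (A_ n M). Proof. exact: (mseq mgamma (mE n M)). Qed.
Let mB : measurable B. Proof. exact: (mseq mgamma mbounded). Qed.

(** Up to a null set [B] is the same event for the path shifted by $n$, which is independent of
    [A_ n M]. *)
Let indepA n M : P (A_ n M `&` B) = (P (A_ n M) * P B)%E.
Proof.
have mS : measurable [set w | bounded (fun i => gamma (n + i)%N w)].
  by apply: (@mseq bounded (fun i => gamma (n + i)%N)) => // i; exact: mgamma.
transitivity (P (A_ n M `&` [set w | bounded (fun i => gamma (n + i)%N w)])).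
  by apply/eqP; rewrite eq_le; apply/andP; split; apply: le_ae;
    [exact: measurableI|exact: measurableI|move=> w w0 [Aw Bw]; split => //;
     apply/(bounded_shift n w0)|exact: measurableI|exact: measurableI|
     move=> w w0 [Aw Bw]; split => //; apply/(bounded_shift n w0)].
have := indep_past_future gamma_indep gamma_id n (mE n M) mbounded.
have -> // : [set w | E_ n M (fun i => if (i < n)%N then gamma i w else 0)] = A_ n M.
apply/seteqP; split=> w Ew k kn; have := Ew k kn; rewrite (@eq_Nseq _ _ (path w)) //;
  by move=> i ik; rewrite /path (leq_trans ik kn).
Qed.

(** The events of [indepA] decrease in $n$ to [C M], a subset of [B], so $P(C_M) = P(C_M) P(B)$;
    then [C M] increases to [B]. *)
Let bounded_zero_one : (P B = P B * P B)%E.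
Proof.
have PBfin : P B \is a fin_num by rewrite fin_num_measure.
pose C M := \bigcap_n A_ n M%:R.
have mC M : measurable (C M) by apply: bigcapT_measurable => n; exact: mA.
have CB M : C M `&` B = C M.
  by apply/setIidPl => w Cw; exists M => // n _; exact: Cw.
have ndA M m n : (m <= n)%N -> A_ n M `<=` A_ m M.
  by move=> mn w Aw k km; apply: Aw; exact: leq_trans mn.
have P_lty (F : set T) : measurable F -> (P F < +oo)%E.
  by move=> mF; rewrite (le_lt_trans (probability_le1 P mF)) ?ltry.
have PC M : P (C M) = (P (C M) * P B)%E.
  have c1 : (P (A_ n M%:R `&` B) @[n --> \oo] --> P (C M))%E.
    rewrite -[in X in _ --> X]CB /C -bigcapIl; last by exists 0%N.
    apply: nonincreasing_cvg_mu.
    - by apply: P_lty; exact: measurableI.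
    - by move=> n; exact: measurableI.
    - by apply: bigcapT_measurable => n; exact: measurableI.
    - by move=> m n mn; apply/subsetPset; apply: setSI; exact: ndA.
  have c2 : (P (A_ n M%:R `&` B) @[n --> \oo] --> P (C M) * P B)%E.
    under eq_fun do rewrite indepA.
    apply: cvgeZr => //; apply: nonincreasing_cvg_mu => //.
    - exact: P_lty.
    - exact: mC.
    - by move=> m n mn; apply/subsetPset; exact: ndA.
  exact: (cvg_unique _ c1 c2).
have UC : \bigcup_M C M = B.
  apply/seteqP; split=> [w [M _ Cw]|w [M _ Bw]]; first by exists M => // n _; exact: Cw.
  by exists M => // n _; exact: Bw.
have c1 : (P (C M) @[M --> \oo] --> P B)%E.
  rewrite -UC; apply: nondecreasing_cvg_mu => //.
  move=> M M' MM'; apply/subsetPset => w Cw n _ k kn.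
  by rewrite (le_trans (Cw n I k kn)) // ler_nat.
have c2 : (P (C M) @[M --> \oo] --> P B * P B)%E.
  under eq_fun do rewrite PC.
  exact: cvgeZr.
exact: (cvg_unique _ c1 c2).
Qed.

Hypothesis q_inv : forall A, measurable A -> q (@GRing.inv R @^-1` A) = q A.

Lemma ae_unbounded : {ae P, forall w, ~ has_ubound (range (Nseq (path w)))}.
Proof.
have PBfin : P B \is a fin_num by rewrite fin_num_measure.
pose B' := [set w | bounded (fun i => (path w i)^-1)].
have mB' : measurable B'.
  apply: (@mseq bounded (fun i w => (gamma i w)^-1)) => // i.
  exact: (measurableT_comp (@measurable_fun_inv R) (mgamma i)).
have PB' : P B' = P B by exact: (law_inv gamma_indep gamma_id q_inv mbounded).
(* By [Nseq_inv] the events [B] and [B'] are disjoint up to a null set, and they have the same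
   probability. *)
have BB' : (P B <= 1 - P B)%E.
  rewrite -[in X in (_ <= _ - X)%E]PB' -probability_setC //.
  apply: le_ae => //; first exact: measurableC.
  move=> w w0 /boundedP[M BM] /boundedP[M' BM'].
  have := Nseq_inv w0 (Num.truncn (M + M')).+1.
  rewrite leNgt => /negP; apply; apply: le_lt_trans (truncnS_gt _).
  by apply: lerD; [apply: BM|apply: BM']; eexists.
have PB0 : P B = 0%E.
  move: BB' bounded_zero_one; rewrite -(fineK PBfin) -EFinB -EFinM lee_fin => p1 [p2].
  (* The relation $p = p^2$ leaves $0$ and $1$, and $p \le 1 - p$ rules out $1$. *)
  have : fine (P B) * (1 - fine (P B)) = 0 by rewrite mulrBr mulr1 -p2 subrr.
  move=> /eqP; rewrite mulf_eq0 => /orP[/eqP -> //|/eqP p3].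
  by congr EFin; lra.
exists B; split => // w /= /contrapT Bw; exact/boundedP.
Qed.

End zero_one.

(** * Application to i.i.d. $GIG(\lambda,a,a)$ factors *)

Section gig_sequence.
Context (R : realType) d (T : measurableType d) (P : probability T R).
Variables (a lambda : R) (gamma : nat -> {RV P >-> R}).
Hypothesis gamma_indep : independent_seq gamma.
Hypothesis gamma_law : forall n, gig_law lambda a (gamma n).

Lemma gig_id n A : measurable A -> P (gamma n @^-1` A) = distribution P (gamma 0) A.
Proof. by move=> mA; rewrite gamma_law //; exact: gamma_law. Qed.

Lemma ae_gig_gt0 : {ae P, forall w, forall i, 0 < gamma i w}.
Proof. by apply: ae_foralln => i; exact: (gig_gt0 (gamma_law i)). Qed.

(** An instance of [prod_geometric_decay] for $x^{-\lambda}$, of mean below $1$ by [gig_moment_lt1];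
    on positive paths the product of powers is the power of the product. *)
Lemma ae_Xseq_decay : lambda != 0 ->
  exists2 rho : R, 0 < rho < 1 & {ae P, forall w,
    \forall n \near \oo, Xseq (fun i => gamma i w) n `^ (- lambda) < rho ^+ n}.
Proof.
move=> l0; pose f (x : R) := x `^ (- lambda).
have mf : measurable_fun setT f by exact: measurable_powR.
have f0 x : 0 <= f x by exact: powR_ge0.
have E1 := gig_moment_lt1 (gamma_law 0) l0.
have E0 : (0 <= \int[P]_w (f (gamma 0%N w))%:E)%E.
  by apply: integral_ge0 => w _; rewrite lee_fin.
pose r := fine (\int[P]_w (f (gamma 0%N w))%:E).
have rE : (\int[P]_w (f (gamma 0%N w))%:E = r%:E)%E.
  by rewrite fineK // ge0_fin_numE // (lt_trans E1) ?ltry.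
have Ef n : (\int[P]_w (f (gamma n w))%:E = r%:E)%E.
  have mEf : measurable_fun setT (EFin \o f) by exact/measurable_EFinP.
  have Ef0 x : (0 <= (EFin \o f) x)%E by rewrite lee_fin.
  by rewrite -rE (gig_expectation (gamma_law n) mEf Ef0) (gig_expectation (gamma_law 0) mEf Ef0).
have r1 : r < 1 by rewrite -lte_fin -rE.
have [rho rho01 H] := prod_geometric_decay gamma_indep gig_id mf f0 Ef r1.
exists rho => //; apply: filterS2 H ae_gig_gt0 => w Hw w0.
by apply: filterS Hw => n; rewrite Xseq_powR.
Qed.

End gig_sequence.

Theorem theorem6p4 (R : realType) (d : measure_display) (T : measurableType d)
    (P : probability T R) (a lambda : R) (gamma : nat -> {RV P >-> R})
    (a_gt0 : 0 < a)
    (gamma_indep : independent_seq gamma)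
    (gamma_law : forall n, gig_law lambda a (gamma n)) :
  (0 < lambda ->
    {ae P, forall w : T,
      let g := fun n => gamma n w in
      let Ninf := limn (Nseq g) in
      cvgn (Nseq g) /\
      forall n : nat, (1 <= n)%N ->
        cvgn (Zpartial g n) /\
        ln (Xseq g n) =
          ln (Zseq g n / Ninf) + ln (1 + Ninf * limn (Zpartial g n))}) /\
  (lambda <= 0 ->
    {ae P, forall w : T,
      let g := fun n => gamma n w in
      forall n : nat, (1 <= n)%N ->
        cvgn (Zpartial g n) /\
        ln (Xseq g n) = ln (Zseq g n) + ln (limn (Zpartial g n))}).
Proof.
have pos := ae_gig_gt0 gamma_law.
split=> [l0|]; last rewrite le_eqVlt => /predU1P[l0|l0].
- have [rho rho01 H] := ae_Xseq_decay gamma_indep gamma_law (lt0r_neq0 l0).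
  apply: filterS2 H pos => w Hw w0 /=.
  exact: ln_Xseq_bounded w0 (Nseq_bounded w0 l0 rho01 Hw).
(* For $\lambda = 0$ the weight $x^{-2\lambda}$ is $1$, which gives the inversion invariance that
   [ae_unbounded] requires. *)
- have gamma_inv A : measurable A ->
    distribution P (gamma 0%N) (@GRing.inv R @^-1` A) = distribution P (gamma 0%N) A.
    exact: (gig_inv_law0 (gamma_law 0%N)).
  have H := ae_unbounded gamma_indep (gig_id gamma_law) pos gamma_inv.
  apply: filterS2 H pos => w Hw w0 /=.
  exact: ln_Xseq_unbounded w0 Hw.
- have [rho rho01 H] := ae_Xseq_decay gamma_indep gamma_law (ltr0_neq0 l0).
  apply: filterS2 H pos => w Hw w0 /=.
  exact: ln_Xseq_unbounded w0 (Nseq_unbounded w0 l0 rho01 Hw).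
Qed.
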